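(* Let $U$ be a bounded operator in a Hilbert space $\mathcal{H}_0$. Let $\mathcal{K}\subset\mathcal{H}_0$ be a closed subspace invariant under $U$ (i.e. $U\mathcal{K}\subset\mathcal{K}$), and let $P$ denote the orthogonal projection of $\mathcal{H}_0$ onto $\mathcal{K}$. Let $J$ be a period-$2$ unitary operator in $\mathcal{H}_0$ which satisfies $$JUJ=U^{*}\qquad\text{and}\qquad PJP\ge 0 .$$ (a) There is a Hilbert space $\mathcal{H}(\mathcal{K})$, a contractive operator $W\colon\mathcal{K}\to\mathcal{H}(\mathcal{K})$ with dense range, and a bounded selfadjoint operator $S=S(U)$ in $\mathcal{H}(\mathcal{K})$ such that $$SW=WUP,\qquad W^{*}W=PJP,\qquad \|S(U)\|\le\bigl(\operatorname{sp}(U^{2})\bigr)^{1/2}.$$ (b) The data $(\mathcal{H}(\mathcal{K}),W,S)$ is unique up to unitary equivalence. Specifically, suppose that for $i=1,2$, $\mathcal{H}_i(\mathcal{K})$ is a Hilbert space, $W_i\colon\mathcal{K}\to\mathcal{H}_i(\mathcal{K})$ is a contractive operator with dense range, and $S_i$ is a bounded selfadjoint operator in $\mathcal{H}_i(\mathcal{K})$ such that $S_iW_i=W_iUP$ and $W_i^{*}W_i=PJP$. Then there is a unitary isomorphism $T$ of $\mathcal{H}_1(\mathcal{K})$ onto $\mathcal{H}_2(\mathcal{K})$ which satisfies $$TW_1=W_2\qquad\text{and}\qquad TS_1=S_2T .$$ (c) There are systems $(\mathcal{H}_0,\mathcal{K},J,U)$, consisting of a Hilbert space $\mathcal{H}_0$,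 a bounded operator $U$ in $\mathcal{H}_0$, a closed subspace $\mathcal{K}\subset\mathcal{H}_0$ with $U\mathcal{K}\subset\mathcal{K}$, and a period-$2$ unitary operator $J$ in $\mathcal{H}_0$ with $JUJ=U^{*}$ and $PJP\ge 0$ (where $P$ is the orthogonal projection of $\mathcal{H}_0$ onto $\mathcal{K}$), such that the operator $W$ from the resulting system $(\mathcal{H}(\mathcal{K}),W,S)$ (with $W\colon\mathcal{K}\to\mathcal{H}(\mathcal{K})$ contractive with dense range, $S$ bounded selfadjoint in $\mathcal{H}(\mathcal{K})$, $SW=WUP$ and $W^{*}W=PJP$) has $\ker(W)=\{0\}$.
   Context: All Hilbert spaces are complex. A period-$2$ unitary operator is a unitary operator $J$ with $J^{2}=I$. The identities $SW=WUP$ and $W^{*}W=PJP$ are identities of operators defined on $\mathcal{K}$ (on $\mathcal{K}$, $UP$ is the restriction $U|_{\mathcal{K}}\colon\mathcal{K}\to\mathcal{K}$, and $PJP$ is the compression of $J$ to $\mathcal{K}$). $\operatorname{sp}(U^{2})$ denotes the spectral radius of $U^{2}$. *)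

(* Defs.v *)
From HB Require Import structures.
From mathcomp Require Import all_boot all_order all_algebra.
From mathcomp Require Import complex.
From mathcomp Require Import boolp classical_sets functions reals.
From mathcomp Require Import topology normedtype.

Set Implicit Arguments.
Unset Strict Implicit.
Unset Printing Implicit Defensive.

Import Order.TTheory GRing.Theory Num.Def Num.Theory.
Import numFieldNormedType.Exports.

Local Open Scope classical_set_scope.
Local Open Scope ring_scope.
Local Open Scope complex_scope.

(* A complex Hilbert space: a complete normed space over R[i] whose norm comes
   from an inner product, linear in the first argument and conjugate-linear in
   the second. *)
HB.mixin Record CompleteNormedModule_isHilbert (R : realType) (H : Type)
    & CompleteNormedModule R[i] H := {
  inner : {dot H for @conjC R[i]} ;
  inner_norm : forall x : H, inner x x = `|x| ^+ 2
}.

#[short(type="hilbertType")]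
HB.structure Definition Hilbert (R : realType) :=
  {H of CompleteNormedModule R[i] H & CompleteNormedModule_isHilbert R H}.

Record closedSubspace (R : realType) (H : hilbertType R) := ClosedSubspace {
  csub_set : set H ;
  csub_closed : closed csub_set ;
  csub_submod : submod_closed (fun x : H => x \in csub_set)
}.

(* A closed subspace, viewed as a type, is a Hilbert space for the inherited
   operations and inner product. *)
Section closed_subspace_hilbert.
Context (R : realType) (H : hilbertType R) (K : closedSubspace H).

Definition csub_pred : pred H := fun x => x \in csub_set K.

Record csub : Type := CSub { csub_val : H ; _ : csub_pred csub_val }.

Lemma csub_pred_submod : subsemimod_closed csub_pred.
Proof.
have [h0 hl] := csub_submod K; split; first split => //.
- by move=> u v hu hv; have := hl 1 _ _ hu hv; rewrite scale1r.
- by move=> a u hu; have := hl a _ _ hu h0; rewrite addr0.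
Qed.

HB.instance Definition _ := [isSub for csub_val].
HB.instance Definition _ := [Choice of csub by <:].
HB.instance Definition _ :=
  GRing.isSubmodClosed.Build R[i] H csub_pred csub_pred_submod.
HB.instance Definition _ := [SubChoice_isSubLmodule of csub by <:].

Let csub_norm (k : csub) : R[i] := `|val k|.

Let csub_normD k l : csub_norm (k + l) <= csub_norm k + csub_norm l.
Proof. exact: ler_normD. Qed.

Let csub_normZ (a : R[i]) k : csub_norm (a *: k) = `|a| * csub_norm k.
Proof. exact: normrZ. Qed.

Let csub_norm0 k : csub_norm k = 0 -> k = 0.
Proof. by move=> /normr0_eq0 k0; apply: val_inj; rewrite k0. Qed.

HB.instance Definition _ :=
  Lmodule_isNormed.Build R[i] csub csub_normD csub_normZ csub_norm0.

Lemma csub_cauchy_cvg (F : set_system csub) :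
  ProperFilter F -> cauchy F -> cvg F.
Proof.
move=> FF /cauchy_ballP Fc.
have GF : ProperFilter (csub_val @ F) by exact: fmap_proper_filter.
have Gc : cauchy (csub_val @ F).
  apply/cauchy_ballP => e e0; have [[A B] /= [FA FB] AB] := Fc _ e0.
  exists (csub_val @` A, csub_val @` B) => /=; first split.
  - by apply: filterS FA => x Ax; exists x.
  - by apply: filterS FB => x Bx; exists x.
  - move=> [_ _] /= [[x Ax <-] [y By <-]].
    by have := AB (x, y) (conj Ax By); rewrite -!ball_normE.
have /cvg_ex[l Gl] : cvg (csub_val @ F) by exact: cauchy_cvg.
have lK : csub_pred l.
  rewrite /csub_pred inE; apply: csub_closed => B /Gl FB.
  have [[x xK] Bx] : exists k, (csub_val @^-1` B) k by exact: (@filter_ex _ F).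
  by exists x; split=> //; exact/set_mem.
apply/cvg_ex; exists (CSub lK); apply/cvgrPdist_lt => e e0.
by move/cvgrPdist_lt : Gl => /(_ e e0).
Qed.

HB.instance Definition _ := Uniform_isComplete.Build csub csub_cauchy_cvg.

Definition csub_inner (k l : csub) : R[i] := inner (val k) (val l).

Let csub_inner_bilinear :
  bilinear_for *%R (@conjC R[i] \; *%R) csub_inner.
Proof.
split=> [l a k k'|k a l l'] /=; rewrite /csub_inner.
- by rewrite linearPl.
- by rewrite linearPr.
Qed.

HB.instance Definition _ :=
  bilinear_isBilinear.Build R[i] csub csub R[i] *%R (@conjC R[i] \; *%R)
    csub_inner csub_inner_bilinear.

Let csub_inner_herm k l :
  csub_inner k l = (-1) ^+ false * (csub_inner l k)^*%R.
Proof. exact: hermC. Qed.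

HB.instance Definition _ :=
  isHermitianSesquilinear.Build R[i] csub false (@conjC R[i])
    csub_inner csub_inner_herm.

Let csub_inner_gt0 k : k != 0 -> 0 < csub_inner k k.
Proof. by move=> k0; apply: neq0_dnorm_gt0. Qed.

HB.instance Definition _ :=
  isDotProduct.Build R[i] csub csub_inner csub_inner_gt0.

Let csub_inner_norm k : csub_inner k k = `|k| ^+ 2.
Proof. exact: inner_norm. Qed.

HB.instance Definition _ :=
  CompleteNormedModule_isHilbert.Build R csub csub_inner_norm.

End closed_subspace_hilbert.

Coercion csub : closedSubspace >-> Sortclass.

Section operators.
Context (R : realType).
Implicit Types H : hilbertType R.

Definition bounded_op H1 H2 (T : {linear H1 -> H2}) : Prop :=
  exists M : R, forall x, `|T x| <= M%:C * `|x|.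

(* Norms take values in R[i]; [complex.Re] reads them as elements of R. *)
Definition opnorm H1 H2 (T : H1 -> H2) : R :=
  sup [set complex.Re `|T x| | x in [set x | `|x| <= 1]].

Definition contractive H1 H2 (T : H1 -> H2) : Prop :=
  forall x, `|T x| <= `|x|.

Definition is_adjoint H1 H2 (T : H1 -> H2) (T' : H2 -> H1) : Prop :=
  forall x y, inner (T x) y = inner x (T' y).

Definition selfadjoint H (T : H -> H) : Prop := is_adjoint T T.

Definition unitary H1 H2 (T : H1 -> H2) : Prop :=
  (forall x y, inner (T x) (T y) = inner x y) /\ range T = setT.

(* In R[i], [0 <= z] says that z is real and nonnegative. *)
Definition positive_op H (T : H -> H) : Prop := forall x, 0 <= inner (T x) x.

Definition spectrum H (T : H -> H) : set R[i] :=
  [set a | ~ exists V : {linear H -> H},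
     [/\ bounded_op V, cancel (fun x => T x - a *: x) V &
         cancel V (fun x => T x - a *: x)]].

(* The spectrum of a bounded operator is bounded, and empty only if H = 0; in
   that case the value is [sup set0 = 0]. *)
Definition spectral_radius H (T : H -> H) : R :=
  sup [set complex.Re `|a| | a in spectrum T].

Definition orthogonal_projection H (K : closedSubspace H) (P : H -> K) : Prop :=
  forall x (k : K), inner (x - val (P x)) (val k) = 0.

Definition invariant_under H (T : H -> H) (K : closedSubspace H) : Prop :=
  forall x, x \in csub_set K -> T x \in csub_set K.

Definition restriction H (T : H -> H) (K : closedSubspace H)
    (TK : invariant_under T K) (k : K) : K :=
  CSub (TK (val k) (valP k)).

Definition compression H (K : closedSubspace H) (P : H -> K) (T : H -> H) :
  K -> K := fun k => P (T (val k)).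

(* [is_adjoint U (J \o U \o J)] is the identity J U J = U^*. *)
Definition reflection_system (H0 : hilbertType R) (K : closedSubspace H0)
    (P : H0 -> K) (U J : {linear H0 -> H0}) : Prop :=
  [/\ bounded_op U, orthogonal_projection P, unitary J, J \o J =1 id &
      is_adjoint U (J \o U \o J) /\ positive_op (compression P J)].

(* [Wadj] is W^* : HK -> K, which is determined by W. *)
Definition induced_system (H0 : hilbertType R) (K : closedSubspace H0)
    (P : H0 -> K) (U J : {linear H0 -> H0}) (UK : invariant_under U K)
    (HK : hilbertType R) (W : {linear K -> HK}) (S : {linear HK -> HK}) : Prop :=
  [/\ contractive W, dense (range W), bounded_op S, selfadjoint S &
      S \o W =1 W \o restriction UK /\
      exists2 Wadj : HK -> K,
        is_adjoint W Wadj & Wadj \o W =1 compression P J].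

End operators.

(* Main.v *)
(** Let [A] be the compression of [J] to [K]. As [0 <= A <= 1] it has a
    self-adjoint square root; [W] is this root, with values in the closure
    of its range, so that [<W k, W l> = <J k, l>]. The relation [J U J =
    U^*] makes [U] symmetric for this form.

    If [N] is symmetric for the form then [n |-> |W N^n k|] is log-convex,
    and it grows at most like [|N|^n], hence [|W N k| <= |N| |W k|]. Applied
    to [U] this defines the self-adjoint operator [S].

    The norm bound does not need the spectral radius formula. Suppose [s^2 >
    sp(U^2)], where [s = |S|]. For every real [b >= s^2] the operator [U^2 -
    b] is invertible, and by connectedness of the ray it maps [K] onto [K],
    since it does so for large [b]. Its inverse on [K] for [b = s^2] is
    again symmetric for the form, hence bounded for the seminorm [|W k|], so
    that [S^2 - s^2] is bounded below. This contradicts [s = |S|].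

    Uniqueness holds because [W k |-> W' k] preserves inner products. *)

Require Import Defs.
From HB Require Import structures.
From mathcomp Require Import all_boot all_order all_algebra.
From mathcomp Require Import complex lra ring.
From mathcomp Require Import boolp classical_sets functions reals.
From mathcomp Require Import topology normedtype sequences.

Set Implicit Arguments.
Unset Strict Implicit.
Unset Printing Implicit Defensive.

Import Order.TTheory GRing.Theory Num.Def Num.Theory.
Import numFieldNormedType.Exports.

Local Open Scope classical_set_scope.
Local Open Scope ring_scope.
Local Open Scope complex_scope.

(** * Real-valued norms *)

Section real_norm.
Context (R : realType) (V : normedModType R[i]).
Implicit Types (x y z : V) (a : R[i]).

(** Norms live in [R[i]], whose order is partial; read in [R] they are open to real arithmetic. *)
Definition nrm x : R := complex.Re `|x|.

Lemma nrmE x : `|x| = (nrm x)%:C.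
Proof. by rewrite /nrm RRe_real// normr_real. Qed.

Lemma le_nrm x (M : R) : (`|x| <= M%:C) = (nrm x <= M).
Proof. by rewrite nrmE lecR. Qed.

Lemma nrm_ge0 x : 0 <= nrm x.
Proof. by rewrite -ler0c -nrmE. Qed.

Lemma nrm0 : nrm 0 = 0.
Proof. by rewrite /nrm normr0. Qed.

Lemma nrm0_eq0 x : nrm x = 0 -> x = 0.
Proof. by move=> x0; apply: normr0_eq0; rewrite nrmE x0. Qed.

Lemma nrmN x : nrm (- x) = nrm x.
Proof. by rewrite /nrm normrN. Qed.

Lemma nrmBC x y : nrm (x - y) = nrm (y - x).
Proof. by rewrite /nrm distrC. Qed.

Lemma nrmZ a x : nrm (a *: x) = complex.Re `|a| * nrm x.
Proof.
have /complex_realP[k kE] : `|a| \is Num.real by exact: normr_real.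
by rewrite /nrm normrZ kE (nrmE x)/= mul0r subr0.
Qed.

Lemma nrmZr (r : R) x : nrm (r%:C *: x) = `|r| * nrm x.
Proof. by rewrite nrmZ normc_def/= expr0n/= addr0 sqrtr_sqr. Qed.

Lemma nrmD x y : nrm (x + y) <= nrm x + nrm y.
Proof. by have := ler_normD x y; rewrite !nrmE -rmorphD lecR. Qed.

Lemma nrmB x y : nrm (x - y) <= nrm x + nrm y.
Proof. by rewrite (le_trans (nrmD _ _))// nrmN. Qed.

Lemma nrm_triangle y x z : nrm (x - z) <= nrm (x - y) + nrm (y - z).
Proof. by apply: le_trans (nrmD _ _); rewrite addrA subrK. Qed.

Lemma nrm_le_eps x (M : R) : (forall e, 0 < e -> nrm x <= M + e) -> nrm x <= M.
Proof. by move=> h; apply/ler_addgt0Pr => e e0; exact: h. Qed.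

Lemma nrm_small x (C : R) : (forall e, 0 < e -> nrm x <= C * e) -> x = 0.
Proof.
move=> h; apply: nrm0_eq0; apply/eqP; rewrite eq_le nrm_ge0 andbT.
apply/ler_addgt0Pr => e e0; rewrite add0r.
(* [C] may be zero or negative, hence the divisor [|C| + 1]. *)
have C0 : 0 < `|C| + 1 by rewrite ltr_wpDl.
apply: le_trans (h (e / (`|C| + 1)) _) _; first by rewrite divr_gt0.
rewrite mulrA ler_pdivrMr// mulrC ler_pM2l//.
by rewrite (le_trans (ler_norm _))// lerDl.
Qed.

Lemma dense_nrm (A : set V) : dense A <->
  forall x e, 0 < e -> exists2 y, A y & nrm (x - y) < e.
Proof.
split=> [dA x e e0|h O [x Ox] oO].
  have ox : nbhs x (ball x (e%:C : R[i])).
    by apply: nbhsx_ballx; rewrite ltcR.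
  have [y [/interior_subset xy Ay]] := dA (ball x (e%:C : R[i]))°
    (ex_intro _ x ox) (@open_interior _ _).
  exists y => //; move: xy; rewrite -ball_normE /ball_ /= nrmE.
  by rewrite ltcR.
have /nbhs_ballP[e /= e0 he] : nbhs x O by exact: open_nbhs_nbhs.
have /complex_realP[r re] : e \is Num.real by rewrite gtr0_real.
rewrite re ltcR in e0.
have [y Ay xy] := h x r e0.
exists y; split => //; apply: he; rewrite -ball_normE /ball_ /= nrmE re.
by rewrite ltcR.
Qed.

Lemma closure_nrm (A : set V) x :
  closure A x <-> forall e, 0 < e -> exists2 y, A y & nrm (x - y) < e.
Proof.
split=> [cA e e0|h B /nbhs_ballP[e /= e0 he]].
  have ox : nbhs x (ball x (e%:C : R[i])).
    by apply: nbhsx_ballx; rewrite ltcR.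
  have [y [Ay]] := cA _ ox.
  by rewrite -ball_normE /ball_ /= nrmE ltcR; exists y.
have /complex_realP[r re] : e \is Num.real by rewrite gtr0_real.
rewrite re ltcR in e0.
have [y Ay xy] := h r e0.
exists y; split => //; apply: he; rewrite -ball_normE /ball_ /= nrmE re.
by rewrite ltcR.
Qed.

End real_norm.

Lemma nrm_bounded_op (R : realType) (H1 H2 : hilbertType R)
    (T : {linear H1 -> H2}) :
  bounded_op T <-> exists2 M : R, 0 <= M & forall x, nrm (T x) <= M * nrm x.
Proof.
split=> [[M hM]|[M _ hM]].
  exists `|M| => // x.
  have := hM x; rewrite (nrmE x) -rmorphM/= le_nrm => /le_trans; apply.
  by rewrite ler_wpM2r ?nrm_ge0// ler_norm.
by exists M => x; rewrite (nrmE x) -rmorphM/= le_nrm.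
Qed.

(** A rate for the increments passes to the limit, so that limits come with error bounds. *)
Lemma nrm_cauchy_rate (R : realType) (V : completeNormedModType R[i])
    (u : nat -> V) (d : nat -> R) :
  (forall e, 0 < e -> exists N, forall n, (N <= n)%N -> d n < e) ->
  (forall n m, (n <= m)%N -> nrm (u m - u n) <= d n) ->
  exists l, forall n, nrm (l - u n) <= d n.
Proof.
move=> d0 ud.
have : cvg (u @ \oo).
  apply/cauchy_cvgP/cauchy_ballP => e e0.
  have /complex_realP[r re] : e \is Num.real by rewrite gtr0_real.
  rewrite re ltcR in e0; have r2 : 0 < r / 2 by rewrite divr_gt0.
  have [N hN] := d0 _ r2.
  exists (u @` [set n | (N <= n)%N], u @` [set n | (N <= n)%N]) => /=.
    by split; exists N => // n /= Nn; exists n.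
  move=> [_ _] /= [[n Nn <-] [m Nm <-]].
  rewrite -ball_normE /ball_ /= nrmE re ltcR.
  apply: le_lt_trans (nrm_triangle (u N) _ _) _.
  rewrite (splitr r); apply: ltrD.
    by apply: le_lt_trans (ud _ _ Nn) _; exact: hN.
  by rewrite nrmBC; apply: le_lt_trans (ud _ _ Nm) _; exact: hN.
move=> /cvg_ex[l ul]; exists l => n.
apply: nrm_le_eps => e e0.
have /cvgrPdist_lt/(_ e%:C) := ul; rewrite ltcR => /(_ e0) [N _ hN].
have := hN (maxn N n) (leq_maxl _ _); rewrite nrmE ltcR => /ltW h.
apply: le_trans (nrm_triangle (u (maxn N n)) _ _) _.
by rewrite addrC lerD// ud// leq_maxr.
Qed.

Lemma harmonic_small (R : realType) (C e : R) : 0 < e ->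
  exists N, forall n, (N <= n)%N -> C / n.+1%:R < e.
Proof.
move=> e0; exists (truncn (`|C| / e)) => n Nn.
rewrite ltr_pdivrMr// mulrC -ltr_pdivrMr//.
apply: le_lt_trans (_ : `|C| / e < _).
  by rewrite ler_pM2r ?invr_gt0// ler_norm.
apply: lt_le_trans (truncnS_gt _) _.
by rewrite ler_nat ltnS.
Qed.

(** * Real inner products *)

Section complex_coordinates.
Context (R : realType).
Implicit Types (a b : R[i]) (r : R).

Lemma ReD a b : complex.Re (a + b) = complex.Re a + complex.Re b.
Proof. by case: a; case: b. Qed.

Lemma ReN a : complex.Re (- a) = - complex.Re a.
Proof. by case: a. Qed.

Lemma ReJ a : complex.Re (conjC a) = complex.Re a.
Proof. by case: a. Qed.

Lemma ReMr r a : complex.Re (r%:C * a) = r * complex.Re a.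
Proof. by case: a => p q /=; rewrite mul0r subr0. Qed.

Lemma ReiM a : complex.Re ('i * a) = - complex.Im a.
Proof. by case: a => p q /=; rewrite mul0r mul1r add0r. Qed.

Lemma eq_ReIm a b : complex.Re a = complex.Re b ->
  complex.Re ('i * a) = complex.Re ('i * b) -> a = b.
Proof. by rewrite !ReiM => + /oppr_inj; case: a;
  case: b => ? ? ? ? /= -> ->. Qed.

End complex_coordinates.

Section real_inner_product.
Context (R : realType) (H : hilbertType R).
Implicit Types (x y z : H) (r : R).

Lemma innerBl x y z : inner (x - y) z = inner x z - inner y z.
Proof. exact: linearBl. Qed.

Lemma innerPl a x y z : inner (a *: x + y) z = a * inner x z + inner y z.
Proof. exact: linearPl. Qed.

Definition rinner x y : R := complex.Re (inner x y).

Lemma rinnerDl x y z : rinner (x + y) z = rinner x z + rinner y z.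
Proof. by rewrite /rinner linearDl ReD. Qed.

Lemma rinnerC x y : rinner x y = rinner y x.
Proof. by rewrite /rinner hermC expr0 mul1r ReJ. Qed.

Lemma rinnerNl x y : rinner (- x) y = - rinner x y.
Proof. by rewrite /rinner linearNl ReN. Qed.

Lemma rinnerBl x y z : rinner (x - y) z = rinner x z - rinner y z.
Proof. by rewrite rinnerDl rinnerNl. Qed.

Lemma rinnerZl r x y : rinner (r%:C *: x) y = r * rinner x y.
Proof. by rewrite /rinner linearZl_LR ReMr. Qed.

Lemma rinnerDr x y z : rinner x (y + z) = rinner x y + rinner x z.
Proof. by rewrite !(rinnerC x) rinnerDl. Qed.

Lemma rinnerNr x y : rinner x (- y) = - rinner x y.
Proof. by rewrite !(rinnerC x) rinnerNl. Qed.

Lemma rinnerBr x y z : rinner x (y - z) = rinner x y - rinner x z.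
Proof. by rewrite !(rinnerC x) rinnerBl. Qed.

Lemma rinnerZr r x y : rinner x (r%:C *: y) = r * rinner x y.
Proof. by rewrite !(rinnerC x) rinnerZl. Qed.

Lemma inner_nrm x : inner x x = (nrm x ^+ 2)%:C.
Proof. by rewrite inner_norm nrmE rmorphXn. Qed.

Lemma rinner_nrm x : rinner x x = nrm x ^+ 2.
Proof. by rewrite /rinner inner_nrm. Qed.

Lemma nrmD_sq x y : nrm (x + y) ^+ 2 = nrm x ^+ 2 + 2 * rinner x y + nrm y ^+ 2.
Proof.
rewrite -!rinner_nrm rinnerDl !rinnerDr (rinnerC y x); ring.
Qed.

Lemma nrmB_sq x y : nrm (x - y) ^+ 2 = nrm x ^+ 2 - 2 * rinner x y + nrm y ^+ 2.
Proof. by rewrite nrmD_sq nrmN rinnerNr mulrN. Qed.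

(** Cauchy-Schwarz: the squared norm of |y| x - |x| y equals 2 |x| |y| (|x| |y| - <x, y>). *)
Lemma rinner_le x y : rinner x y <= nrm x * nrm y.
Proof.
have := sqr_ge0 (nrm ((nrm y)%:C *: x - (nrm x)%:C *: y)).
rewrite nrmB_sq rinnerZl rinnerZr !nrmZr !ger0_norm ?nrm_ge0//.
have [x0|x0] := eqVneq (nrm x) 0.
  by move=> _; rewrite (nrm0_eq0 x0) nrm0 mul0r /rinner linear0l /= lexx.
have [y0|y0] := eqVneq (nrm y) 0.
  by move=> _; rewrite (nrm0_eq0 y0) nrm0 mulr0 /rinner linear0r /= lexx.
have xy : 0 < nrm x * nrm y by rewrite mulr_gt0// lt_def nrm_ge0 ?x0 ?y0.
rewrite (_ : _ + _ = 2 * (nrm x * nrm y) * (nrm x * nrm y - rinner x y)).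
  by rewrite pmulr_rge0 ?subr_ge0// mulr_gt0.
ring.
Qed.

End real_inner_product.

(** The real part of [inner ('i *: x) y] is minus the imaginary part of [inner x y], so complex
    identities reduce to real ones. *)
Lemma eq_inner_rinner (R : realType) (H1 H2 : hilbertType R)
    (x y : H1) (x' y' : H2) :
  rinner x y = rinner x' y' ->
  rinner ('i%C *: x) y = rinner ('i%C *: x') y' -> inner x y = inner x' y'.
Proof.
move=> re im; apply: eq_ReIm; first exact: re.
by have := im; rewrite /rinner !linearZl_LR.
Qed.

Lemma is_adjoint_rinner (R : realType) (H1 H2 : hilbertType R)
    (T : {linear H1 -> H2}) (T' : H2 -> H1) :
  (forall x y, rinner (T x) y = rinner x (T' y)) -> is_adjoint T T'.
Proof. by move=> h x y; apply: eq_inner_rinner; rewrite -?linearZ h. Qed.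

(** * Extension from a dense range *)

Section dense_extension.
Context (R : realType).

(* [f] stands for a quantity that depends continuously on [x] and is nonpositive
   for [x] in [A]. *)
Lemma dense_le0 (V : normedModType R[i]) (A : set V) (x : V) (C f : R) :
  dense A -> (forall y, A y -> f <= C * nrm (x - y)) -> f <= 0.
Proof.
move=> /dense_nrm dA h; apply/ler_addgt0Pr => e e0; rewrite add0r.
have C0 : 0 < `|C| + 1 by rewrite ltr_wpDl.
have [y Ay /ltW xy] := dA x _ (divr_gt0 e0 C0).
apply: le_trans (h _ Ay) _.
apply: (@le_trans _ _ ((`|C| + 1) * nrm (x - y))).
  by rewrite ler_wpM2r ?nrm_ge0// (le_trans (ler_norm _))// lerDl.
by rewrite mulrC -ler_pdivlMr.
Qed.

Lemma eq_dense (V W : hilbertType R) (A : set V) (T T' : {linear V -> W}) :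
  dense A -> bounded_op T -> bounded_op T' ->
  (forall y, A y -> T y = T' y) -> T =1 T'.
Proof.
move=> dA /nrm_bounded_op[M _ hM] /nrm_bounded_op[M' _ hM'] eqA x.
apply/subr0_eq/nrm0_eq0/le_anti; rewrite nrm_ge0 andbT.
apply: (@dense_le0 _ _ x (M + M')) dA _ => y Ay.
rewrite (_ : _ - _ = T (x - y) - T' (x - y)); last first.
  by rewrite (linearB T) (linearB T') (eqA _ Ay) opprB addrA subrK.
apply: le_trans (nrmB _ _) _; rewrite mulrDl; exact: lerD.
Qed.

Context (K : lmodType R[i]) (H1 H2 : hilbertType R).
Context (W : {linear K -> H1}) (G : {linear K -> H2}) (C : R).
Hypothesis C_ge0 : 0 <= C.
Hypothesis W_dense : dense (range W).
Hypothesis G_le : forall k, nrm (G k) <= C * nrm (W k).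

(** Encodes that [l] is the value at [x] of the extension of W k |-> G k, with no choice of an
    approximating sequence. *)
Let graph (x : H1) (l : H2) : Prop :=
  forall k, nrm (l - G k) <= C * nrm (x - W k).

Let graph_exists x : exists l, graph x l.
Proof.
have /dense_nrm dW := W_dense.
have /choice[k hk] : forall n : nat, exists k, nrm (x - W k) < n.+1%:R^-1.
  move=> n; have [|_ [k _ <-] xk] := dW x n.+1%:R^-1; first by rewrite invr_gt0.
  by exists k.
have hk' n m : (n <= m)%N -> nrm (x - W (k m)) <= n.+1%:R^-1.
  move=> nm; apply: le_trans (ltW (hk m)) _.
  by rewrite lef_pV2 ?posrE// ler_nat ltnS.
have [] := @nrm_cauchy_rate _ H2 (G \o k) (fun n => (2 * C) / n.+1%:R).
- exact: harmonic_small.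
- move=> n m nm /=; rewrite -linearB; apply: le_trans (G_le _) _.
  rewrite linearB -mulrA mulrCA ler_wpM2l//.
  apply: le_trans (nrm_triangle x _ _) _.
  by rewrite mulr_natl mulr2n lerD// ?hk'// nrmBC hk'.
move=> l hl; exists l => k0.
apply/ler_addgt0Pr => e e0.
(* [2 * C] comes from the limit, one more [C] from comparing [W (k N)] with [x]. *)
have [N /(_ N (leqnn _)) hN] := harmonic_small (3 * C) e0.
apply: le_trans (nrm_triangle (G (k N)) _ _) _.
apply: le_trans (lerD (hl N) (_ : _ <= C * (N.+1%:R^-1 + nrm (x - W k0)))) _.
  rewrite -linearB; apply: le_trans (G_le _) _; rewrite linearB ler_wpM2l//.
  apply: le_trans (nrm_triangle x _ _) _; rewrite lerD2r nrmBC.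
  exact: hk'.
by move: hN; move: N.+1%:R^-1 (nrm _) => r t; nra.
Qed.

Let graph_linear a x y l m n : graph x l -> graph y m -> graph (a *: x + y) n ->
  n = a *: l + m.
Proof.
move=> hl hm hn; apply/subr0_eq.
(* Replacing [x] and [y] by [W k1] and [W k2] within [e] costs C (|a| + 1) e on either side of the
   equation. *)
apply: (@nrm_small _ _ _ (2 * C * (complex.Re `|a| + 1))) => e e0.
have /dense_nrm dW := W_dense.
have [_ [k1 _ <-] /ltW xk] := dW x e e0.
have [_ [k2 _ <-] /ltW yk] := dW y e e0.
have a0 : 0 <= complex.Re `|a| by rewrite normc_def sqrtr_ge0.
have b1 := hl k1; have b2 := hm k2; have b3 := hn (a *: k1 + k2).
rewrite (linearP W) (linearP G) in b3.
have b4 : nrm (a *: x + y - (a *: W k1 + W k2)) <= complex.Re `|a| * e + e.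
  rewrite opprD addrACA -scalerBr; apply: le_trans (nrmD _ _) _.
  by rewrite nrmZ lerD// ler_wpM2l.
have b5 : nrm (a *: G k1 + G k2 - (a *: l + m)) <= complex.Re `|a| * (C * e) +
  C * e.
  rewrite opprD addrACA -scalerBr; apply: le_trans (nrmD _ _) _.
  rewrite nrmZ lerD// 1?ler_wpM2l// nrmBC.
    by apply: le_trans b1 _; rewrite ler_wpM2l.
  by apply: le_trans b2 _; rewrite ler_wpM2l.
apply: le_trans (nrm_triangle (a *: G k1 + G k2) _ _) _.
apply: le_trans (lerD (le_trans b3 (ler_wpM2l C_ge0 b4)) b5) _.
by rewrite le_eqVlt; apply/orP; left; apply/eqP; ring.
Qed.

(** By [G_le] the rule W k |-> G k is well defined and Lipschitz on a dense subspace. This yields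
    both [S] and the unitary [T]. *)
Lemma dense_extension : exists T : {linear H1 -> H2},
  T \o W =1 G /\ forall x, nrm (T x) <= C * nrm x.
Proof.
have [T hT] := choice graph_exists.
have Tlin : linear T by move=> a x y; exact: graph_linear.
pose TL := GRing.isLinear.Build _ _ _ _ T Tlin.
pose Tl : {linear H1 -> H2} := HB.pack T TL.
exists Tl; split=> [k|x] /=.
  by have := hT (W k) k; rewrite subrr nrm0 mulr0 => h;
    apply/subr0_eq/nrm0_eq0/le_anti; rewrite h nrm_ge0.
by have := hT x 0; rewrite (linear0 W) (linear0 G) !subr0.
Qed.

End dense_extension.

(** * Boundedness of symmetrizable operators *)

Section symmetrized_operators.
Context (R : realType).
Implicit Types (a : nat -> R) (q C e M : R).

Lemma geometric_small q C e : 0 <= q -> q < 1 -> 0 < e ->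
  exists N, forall n, (N <= n)%N -> C * q ^+ n < e.
Proof.
move=> q0 q1 e0.
have /cvgrPdist_lt h : (GRing.exp q @ \oo) --> (0 : R).
  by apply: cvg_expr; rewrite ger0_norm.
have C0 : 0 < `|C| + 1 by rewrite ltr_wpDl.
have [N _ hN] := h _ (divr_gt0 e0 C0).
exists N => n /hN /=; rewrite sub0r normrN ger0_norm ?exprn_ge0//.
rewrite ltr_pdivlMr// mulrC; apply: le_lt_trans.
by rewrite ler_wpM2r ?exprn_ge0// (le_trans (ler_norm _))// lerDl.
Qed.

(** If a 1 > M a 0, log-convexity keeps every ratio of successive terms at least q = a 1 / a 0 > M,
    and a 0 q^n outgrows C M^n. *)
Lemma log_convex_le a M C : 0 <= M -> (forall n, 0 <= a n) ->
  (forall n, a n.+1 ^+ 2 <= a n * a n.+2) -> (forall n, a n <= C * M ^+ n) ->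
  a 1%N <= M * a 0%N.
Proof.
move=> M0 a_ge0 logconv aM; rewrite leNgt; apply/negP => Ma.
have a0_gt0 : 0 < a 0%N.
  rewrite lt_def a_ge0 andbT; apply/eqP => a00.
  have := logconv 0%N; rewrite a00 mul0r => a1.
  have /eqP := le_anti (introT andP (conj a1 (sqr_ge0 _))).
  by rewrite sqrf_eq0 => /eqP a10; rewrite a00 a10 mulr0 ltxx in Ma.
pose q := a 1%N / a 0%N.
have Mq : M < q by rewrite ltr_pdivlMr.
have q0 : 0 < q := le_lt_trans M0 Mq.
have step n : 0 < a n /\ q * a n <= a n.+1.
  elim: n => [|n [an qan]]; first by rewrite a0_gt0 divfK ?gt_eqF.
  have an1 : 0 < a n.+1 by apply: lt_le_trans qan; rewrite mulr_gt0.
  split=> //; rewrite -(ler_pM2l an); apply: le_trans (logconv n).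
  by rewrite mulrCA mulrA expr2 ler_wpM2r// ltW.
have grow n : a 0%N * q ^+ n <= a n.
  elim: n => [|n IH]; first by rewrite expr0 mulr1.
  have [_] := step n; apply: le_trans.
  by rewrite exprS mulrCA ler_pM2l.
have Mq1 : M / q < 1 by rewrite ltr_pdivrMr// mul1r.
have [N /(_ N (leqnn _))] := geometric_small C (divr_ge0 M0 (ltW q0)) Mq1
  a0_gt0.
rewrite expr_div_n mulrA ltr_pdivrMr ?exprn_gt0// => /(le_lt_trans (aM N)).
by rewrite ltNge grow.
Qed.

(* The sequence [nrm (W (N^n k))] is log-convex by Cauchy-Schwarz and grows at
   most like [M^n], so its first ratio is at most [M]. *)
Lemma symmetrized_le (K H : hilbertType R) (W : K -> H) (N : K -> K) M :
  0 <= M -> (forall k, nrm (W k) <= nrm k) ->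
  (forall k, nrm (N k) <= M * nrm k) ->
  (forall k l, rinner (W (N k)) (W l) = rinner (W k) (W (N l))) ->
  forall k, nrm (W (N k)) <= M * nrm (W k).
Proof.
move=> M0 W1 NM symN k.
apply: (@log_convex_le (fun n => nrm (W (iter n N k))) M (nrm k)) => // n.
- exact: nrm_ge0.
- by rewrite -rinner_nrm /= symN; exact: rinner_le.
- apply: le_trans (W1 _) _; elim: n => [|n IH]; first by rewrite expr0 mulr1.
  by apply: le_trans (NM _) _; rewrite exprS mulrCA ler_wpM2l.
Qed.

End symmetrized_operators.

(** * Square roots *)

(* The iteration [Y' = (B + Y^2) / 2] started at [0] converges to a solution
   of [(1 - Y)^2 = 1 - B]. The increments of [Y n] are dominated in norm by
   those of the same iteration on real numbers, with [B] replaced by [1]. *)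
Section square_root.
Context (R : realType) (K : hilbertType R) (B : {linear K -> K}).
Hypothesis B_sym : forall x y, rinner (B x) y = rinner x (B y).
Hypothesis B_ge0 : forall x, 0 <= rinner (B x) x.
Hypothesis B_le1 : forall x, rinner (B x) x <= nrm x ^+ 2.

(** [B_ge0] at [x - B x] gives 2 |B x|^2 <= <B x, x> + <B (B x), B x>, which [B_le1] bounds by |x|^2
    + |B x|^2. *)
Let B_le x : nrm (B x) <= nrm x.
Proof.
have := B_ge0 (x - B x); have := B_le1 x; have := B_le1 (B x).
rewrite (linearB B) rinnerBl !rinnerBr rinner_nrm (B_sym (B x) x) rinner_nrm.
move=> h1 h2 h3; rewrite -(@ler_pXn2r _ 2) ?nnegrE ?nrm_ge0//.
lra.
Qed.

Let half : R[i] := (2^-1 : R)%:C.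

Let Y := fix Y n : K -> K :=
  if n is n'.+1 then fun x => half *: (B x + Y n' (Y n' x)) else fun=> 0.

Let y := fix y n : R := if n is n'.+1 then (1 + y n' ^+ 2) / 2 else 0.

Let Y_linear n : linear (Y n).
Proof.
elim: n => [|n IH] a u v /=; first by rewrite scaler0 addr0.
rewrite !IH (linearP B) scalerA mulrC -scalerA -scalerDr; congr (_ *: _).
by rewrite scalerDr addrACA.
Qed.

Let YB n u v : Y n (u - v) = Y n u - Y n v.
Proof. by have := Y_linear n (-1) v u; rewrite !scaleN1r !(addrC (- _)). Qed.

Let nrm_half (u : K) : nrm (half *: u) = nrm u / 2.
Proof. by rewrite nrmZr ger0_norm ?invr_ge0// mulrC. Qed.

Let y_ge0 n : 0 <= y n.
Proof. by case: n => //= n; rewrite divr_ge0// addr_ge0// sqr_ge0. Qed.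

Let Y_le n x : nrm (Y n x) <= y n * nrm x.
Proof.
elim: n x => [|n IH] x /=; first by rewrite nrm0 mul0r.
rewrite nrm_half mulrAC ler_pM2r ?invr_gt0//.
apply: le_trans (nrmD _ _) _; rewrite mulrDl mul1r lerD//.
by apply: le_trans (IH _) _; rewrite expr2 -mulrA ler_wpM2l.
Qed.

Let Y_step n x : nrm (Y n.+1 x - Y n x) <= (y n.+1 - y n) * nrm x.
Proof.
elim: n x => [|n IH] x.
  by rewrite !subr0; exact: Y_le.
rewrite [Y n.+2 x]/= [in X in nrm (_ - X)]/= -scalerBr nrm_half.
rewrite opprD addrACA subrr add0r.
(* Splitting Y'^2 - Y^2 as Y' (Y' - Y) + (Y' - Y) Y needs no commutation, and [IH] bounds the
   increment in both terms. *)
have -> : Y n.+1 (Y n.+1 x) - Y n (Y n x) =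
    Y n.+1 (Y n.+1 x - Y n x) + (Y n.+1 (Y n x) - Y n (Y n x)).
  by rewrite YB addrA subrK.
rewrite ler_pdivrMr//; apply: le_trans (nrmD _ _) _.
have y0 := y_ge0 n.+1.
apply: le_trans (lerD (le_trans (Y_le _ _) (ler_wpM2l y0 (IH _))) (IH _)) _.
have yy : 0 <= y n.+1 - y n by rewrite /= (_ : _ - _ = (1 - y n) ^+ 2 / 2)
  ?divr_ge0 ?sqr_ge0//; field.
apply: le_trans (lerD (lexx _) (ler_wpM2l yy (Y_le _ _))) _.
have yE k : y k.+1 = (1 + y k ^+ 2) / 2 by [].
rewrite (yE n.+1) [X in _ <= (_ - X) * _ * _]yE.
by move: (y n.+1) (y n) (nrm x) => r s t; rewrite le_eqVlt; apply/orP; left;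
  apply/eqP; field.
Qed.

(** The gap d = 1 - y n follows d' = d - d^2 / 2, hence decays like 2 / n. *)
Let y_rate n : 0 <= 1 - y n <= 2 / n.+1%:R.
Proof.
(* The induction runs on the sharper bound with [n.+2], an equality at [n = 0]. *)
suff : 0 <= 1 - y n <= 2 / n.+2%:R.
  move=> /andP[-> h]; apply: le_trans h _.
  by rewrite ler_pM2l// lef_pV2 ?posrE// ler_nat.
elim: n => [|n /andP[h0]] /=; first by rewrite subr0 ler01 divff ?lexx
  ?pnatr_eq0.
rewrite ler_pdivlMr// => h1.
have -> : 1 - (1 + y n ^+ 2) / 2 = (1 - y n) * (2 - (1 - y n)) / 2 by field.
have := y_ge0 n; move: h0 h1; set d := 1 - y n;
  have -> : y n = 1 - d by rewrite /d; ring.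
rewrite -!(@natr1 R n.+2) -!(@natr1 R n.+1) => d0 h1 d1.
have n1 : 1 <= n.+1%:R :> R by rewrite ler1n.
move: n1 h1; move: (n.+1%:R) => t t1 h1.
apply/andP; split; first nra.
rewrite ler_pdivlMr; last lra.
nra.
Qed.

Let Y_cauchy x n m : (n <= m)%N -> nrm (Y m x - Y n x) <= (2 * nrm x) / n.+1%:R.
Proof.
move=> nm; have /andP[_ yn] := y_rate n; have /andP[ym _] := y_rate m.
apply: (@le_trans _ _ ((y m - y n) * nrm x)); last first.
  by rewrite mulrAC ler_wpM2r ?nrm_ge0//; apply: le_trans yn;
    rewrite lerD2r -subr_ge0.
elim: m nm {ym} => [|m IH]; first by rewrite leqn0 => /eqP ->;
  rewrite !subrr nrm0 mul0r.
rewrite leq_eqVlt => /predU1P[->|]; first by rewrite !subrr nrm0 mul0r.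
rewrite ltnS => /IH h; apply: le_trans (nrm_triangle (Y m x) _ _) _.
apply: le_trans (lerD (Y_step _ _) h) _.
by rewrite -mulrDl addrA subrK.
Qed.

Lemma rate_eq0 (u : K) C : (forall n, nrm u <= C / n.+1%:R) -> u = 0.
Proof.
move=> h; apply/nrm0_eq0/le_anti; rewrite nrm_ge0 andbT.
apply/ler_addgt0Pr => e e0; rewrite add0r.
have [N /(_ N (leqnn _)) hN] := harmonic_small C e0.
exact: le_trans (h N) (ltW hN).
Qed.

Lemma square_root_exists : exists Q : {linear K -> K},
  (forall x y, rinner (Q x) y = rinner x (Q y)) /\ forall x, Q (Q x) = x - B x.
Proof.
have /choice[Z hZ] : forall x, exists l,
    forall n, nrm (l - Y n x) <= (2 * nrm x) / n.+1%:R.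
  move=> x; apply: (@nrm_cauchy_rate _ K (fun n => Y n x)).
    exact: harmonic_small.
  by move=> n m; exact: Y_cauchy.
have Z_linear : linear Z.
  move=> a u v; apply/subr0_eq.
  apply: (@rate_eq0 _ (2 * nrm (a *: u + v) +
     (complex.Re `|a| * (2 * nrm u) + 2 * nrm v))) => n.
  apply: le_trans (nrm_triangle (Y n (a *: u + v)) _ _) _.
  rewrite mulrDl lerD// Y_linear opprD addrACA -scalerBr.
  apply: le_trans (nrmD _ _) _; rewrite nrmZ mulrDl -mulrA lerD//.
    by rewrite ler_wpM2l ?normc_def ?sqrtr_ge0// nrmBC.
  by rewrite nrmBC.
have Y_sym n u v : rinner (Y n u) v = rinner u (Y n v).
  elim: n u v => [|n IH] u v /=; first by rewrite /rinner linear0l linear0r.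
  by rewrite rinnerZl rinnerZr rinnerDl rinnerDr B_sym !IH.
have Z_sym u v : rinner (Z u) v = rinner u (Z v).
  (* Exchanging the arguments turns one inequality into the other. *)
  suff sym_le w t : rinner (Z w) t <= rinner w (Z t).
    by apply/le_anti; rewrite sym_le rinnerC (rinnerC _ v) sym_le.
  rewrite -subr_le0; apply/ler_addgt0Pr => e e0; rewrite add0r.
  have [N /(_ N (leqnn _))/ltW] := harmonic_small (4 * nrm w * nrm t) e0.
  apply: le_trans.
  have -> : rinner (Z w) t - rinner w (Z t) =
     rinner (Z w - Y N w) t + rinner w (Y N t - Z t).
    by rewrite rinnerBl rinnerBr Y_sym addrA subrK.
  have h1 := le_trans (rinner_le (Z w - Y N w) t) (ler_wpM2r (nrm_ge0 t) (hZ w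
    N)).
  have := le_trans (rinner_le w (Y N t - Z t)) (ler_wpM2l (nrm_ge0 w) _).
  rewrite nrmBC => /(_ _ (hZ t N)) h2; apply: le_trans (lerD h1 h2) _.
  by move: N.+1%:R^-1 => r; rewrite le_eqVlt; apply/orP; left; apply/eqP; ring.
have Z_fix u : Z u = half *: (B u + Z (Z u)).
  (* The recursion passes to the limit: [2 * nrm u] accounts for the error of [Y n.+1 u], and
     [nrm u + nrm (Z u)] for that of half of [Y n (Y n u)]. *)
  apply/subr0_eq/(@rate_eq0 _ (2 * nrm u + (nrm u + nrm (Z u)))) => n.
  apply: le_trans (nrm_triangle (Y n.+1 u) _ _) _; rewrite mulrDl lerD//.
    apply: le_trans (hZ _ _) _.
    by rewrite ler_wpM2l ?mulr_ge0 ?nrm_ge0// lef_pV2 ?posrE// ler_nat.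
  rewrite /= -scalerBr nrm_half opprD addrACA subrr add0r ler_pdivrMr//.
  apply: le_trans (nrm_triangle (Y n (Z u)) _ _) _.
  rewrite -YB mulrDl mulrDl lerD//.
    apply: le_trans (Y_le _ _) _.
    have /andP[y1 _] := y_rate n; have := hZ u n; rewrite nrmBC => h.
    apply: le_trans (ler_wpM2l (y_ge0 n) h) _.
    rewrite (_ : _ * 2 = 1 * (2 * nrm u / n.+1%:R)); last by ring.
    by rewrite ler_wpM2r ?mulr_ge0 ?invr_ge0 ?nrm_ge0// -subr_ge0.
  by rewrite nrmBC mulrAC (mulrC _ 2).
pose ZL := GRing.isLinear.Build _ _ _ _ Z Z_linear.
pose Zl : {linear K -> K} := HB.pack Z ZL.
(* The root is Q = 1 - Z: since 2 Z = B + Z^2, its square is 1 - 2 Z + Z^2 = 1 - B. *)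
exists (idfun \- Zl); split=> [u v|u] /=.
  by rewrite rinnerBl rinnerBr Z_sym.
have -> : Z (u - Z u) = Z u - Z (Z u) by exact: (linearB Zl).
have : Z u + Z u = B u + Z (Z u).
  rewrite [in LHS]Z_fix -scalerDl (_ : half + half = 1) ?scale1r//.
  by rewrite /half -rmorphD -[X in X + X]mul1r -splitr.
move=> /esym/(canRL (addrK _)) ->.
by rewrite -addrA -opprD addrA.
Qed.

End square_root.

(** * Corestriction to the closure of the range *)

Section closed_range.
Context (R : realType) (K : hilbertType R) (Q : {linear K -> K}).

Lemma rinner_csub (L : closedSubspace K) (x y : L) :
  rinner x y = rinner (val x) (val y).
Proof. by []. Qed.

Let closure_range_submod : submod_closed (fun x : K => x \in closure (range Q)).
Proof.
split=> [|a u v].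
  by rewrite unfold_in; apply/mem_set; apply: subset_closure; exists 0 => //;
    exact: linear0.
rewrite !unfold_in => /set_mem/closure_nrm hu /set_mem/closure_nrm hv.
apply/mem_set/closure_nrm => e e0.
have a0 : 0 < complex.Re `|a| + 1 by rewrite ltr_wpDl// normc_def sqrtr_ge0.
have [_ [k _ <-] /ltW uk] := hu _ (divr_gt0 (divr_gt0 e0 (ltr0n _ 2)) a0).
have [_ [l _ <-] vl] := hv _ (divr_gt0 e0 (ltr0n _ 2)).
exists (Q (a *: k + l)); first by exists (a *: k + l).
rewrite (linearP Q) opprD addrACA -scalerBr (splitr e).
apply: le_lt_trans (nrmD _ _) _; apply: ler_ltD vl.
move: uk; rewrite ler_pdivlMr// mulrC nrmZ; apply: le_trans.
by rewrite ler_wpM2r ?nrm_ge0// lerDl.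
Qed.

(** The codomain is the closure of the range: closed, hence a Hilbert space, and the range is dense
    in it. *)
Lemma closed_range_factor : exists (L : closedSubspace K) (W : {linear K -> L}),
  (forall k, val (W k) = Q k) /\ dense (range W).
Proof.
pose L := ClosedSubspace (@closed_closure _ (range Q)) closure_range_submod.
have QL k : csub_pred L (Q k).
  by rewrite /csub_pred inE; apply: subset_closure; exists k.
pose W k : L := CSub (QL k).
have W_linear : linear W by move=> a u v; apply: val_inj; exact: (linearP Q).
pose WL := GRing.isLinear.Build _ _ _ _ W W_linear.
pose Wl : {linear K -> L} := HB.pack W WL.
exists L, Wl; split=> //; apply/dense_nrm => x e e0.
have : closure (range Q) (val x) by have := valP x; rewrite inE.
move=> /closure_nrm/(_ _ e0)[_ [k _ <-] xk].
by exists (Wl k) => //; exists k.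
Qed.

End closed_range.

(** * Spectra and invariant subspaces *)

Section bounded_below_operators.
Context (R : realType) (H : hilbertType R).
Implicit Types (T D : {linear H -> H}) (a : R[i]) (c m q r : R).

(** Contraction principle: all iterates of [0] stay within [d], the sum of the geometric series of
    steps, so [u n] converges at rate [d * q ^+ n]. *)
Lemma nrm_fixpoint (f : H -> H) q : 0 <= q -> q < 1 ->
  (forall x y, nrm (f x - f y) <= q * nrm (x - y)) -> exists p, f p = p.
Proof.
move=> q0 q1 fq; pose u n := iter n f 0; pose d := nrm (f 0) / (1 - q).
have q1' : 0 < 1 - q by rewrite subr_gt0.
have u0 n : nrm (u n - u 0%N) <= d.
  elim: n => [|n IH]; first by rewrite subrr nrm0 divr_ge0 ?nrm_ge0// ltW.
  apply: le_trans (nrm_triangle (f (u 0%N)) _ _) _.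
  apply: le_trans (lerD (le_trans (fq _ _) (ler_wpM2l q0 IH)) (lexx _)) _.
  rewrite subr0 -/(f 0) le_eqVlt; apply/orP; left; apply/eqP.
  by rewrite /d /u /=; field; rewrite gt_eqF.
have uq n k : nrm (u (n + k)%N - u n) <= q ^+ n * nrm (u k - u 0%N).
  elim: n => [|n IH]; first by rewrite mul1r.
  by apply: le_trans (fq _ _) _; rewrite exprS -mulrA ler_wpM2l.
have [|n m nm|p hp] := @nrm_cauchy_rate _ H u (fun n => d * q ^+ n).
- by move=> e; exact: geometric_small.
- by rewrite -(subnKC nm) mulrC; apply: le_trans (uq _ _) _;
  rewrite ler_wpM2l// exprn_ge0.
exists p; apply/subr0_eq/(@nrm_small _ _ _ 2) => e e0.
have [N /(_ N (leqnn _)) hN] := geometric_small d q0 q1 e0.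
apply: le_trans (nrm_triangle (u N.+1) _ _) _.
rewrite mulr_natl mulr2n lerD//.
  apply: le_trans (fq p (u N)) _; apply: le_trans (ltW hN).
  by apply: le_trans (hp N); rewrite ler_piMl ?nrm_ge0// ltW.
rewrite nrmBC; apply: le_trans (hp _) _; apply: le_trans (ltW hN).
have d0 : 0 <= d by rewrite divr_ge0 ?nrm_ge0// ltW.
by rewrite ler_wpM2l// exprS ler_piMl ?exprn_ge0// ltW.
Qed.

(** A solution is a fixed point of l |-> D^-1 (k - E l), a contraction with factor m / c. *)
Lemma surjective_perturbation D (E : H -> H) c m :
  0 <= m -> m < c -> (forall x, c * nrm x <= nrm (D x)) ->
  (forall x y, nrm (E x - E y) <= m * nrm (x - y)) ->
  (forall k, exists l, D l = k) -> forall k, exists l, D l + E l = k.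
Proof.
move=> m0 mc Dc Em /choice[g gK] k.
have c0 : 0 < c := le_lt_trans m0 mc.
have [||x y|p hp] := @nrm_fixpoint (fun l => g (k - E l)) (m / c).
- by rewrite divr_ge0// ltW.
- by rewrite ltr_pdivrMr// mul1r.
- rewrite mulrAC ler_pdivlMr// mulrC; apply: le_trans (Dc _) _.
  by rewrite (linearB D) !gK opprB addrC addrA addrNK nrmBC.
by exists p; rewrite -[X in D X]hp gK subrK.
Qed.

Lemma bounded_below_inverse D c : 0 < c -> (forall x, c * nrm x <= nrm (D x)) ->
  (forall k, exists l, D l = k) ->
  exists V : {linear H -> H}, [/\ cancel D V, cancel V D & forall x, nrm (V x)
    <= c^-1 * nrm x].
Proof.
move=> c0 Dc /choice[g gK].
have D_inj x y : D x = D y -> x = y.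
  move=> Dxy; apply/subr0_eq/nrm0_eq0/le_anti; rewrite nrm_ge0 andbT.
  by rewrite -(pmulr_rle0 _ c0) (le_trans (Dc _))// (linearB D) Dxy subrr nrm0.
have g_linear : linear g.
  by move=> a x y; apply: D_inj; rewrite (linearP D) !gK.
pose gL := GRing.isLinear.Build _ _ _ _ g g_linear.
pose V : {linear H -> H} := HB.pack g gL.
exists V; split=> [x|//|x]; first by apply: D_inj; rewrite gK.
by rewrite mulrC ler_pdivlMr// mulrC -[X in _ <= nrm X]gK.
Qed.

Definition op_shift T a : H -> H := fun x => T x - a *: x.

Lemma op_shift_linear T a : linear (op_shift T a).
Proof.
by move=> b x y; rewrite /op_shift (linearP T) scalerDr scalerBr !scalerA
  (mulrC a) opprD addrACA.
Qed.

HB.instance Definition _ T a := GRing.isLinear.Build _ _ _ _ (op_shift T a)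
  (op_shift_linear T a).

Lemma nrm_shift_ge T a M : (forall x, nrm (T x) <= M * nrm x) ->
  forall x, (complex.Re `|a| - M) * nrm x <= nrm (op_shift T a x).
Proof.
move=> TM x; rewrite mulrBl lerBlDr -nrmZ nrmBC.
rewrite -[X in nrm X <= _](subrK (T x)); apply: le_trans (nrmD _ _) _.
by rewrite lerD// nrmBC.
Qed.

(** [T - a] perturbs the surjective operator [- a], bounded below by |a|, by [T], whose norm is at
    most M < |a|. *)
Lemma shift_surjective T a M : 0 <= M -> (forall x, nrm (T x) <= M * nrm x) ->
  M < complex.Re `|a| -> forall k, exists l, op_shift T a l = k.
Proof.
move=> M0 TM aM k.
have a0 : a != 0 by apply: contraTneq aM => ->; rewrite normr0 -leNgt.
pose D : {linear H -> H} := ( *:%R (- a)).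
have [|||l <-] := @surjective_perturbation D T _ _ M0 aM _ _ _ k.
- by move=> x; rewrite /D /= nrmZ normrN.
- by move=> x y; rewrite -linearB.
- by move=> y; exists ((- a)^-1 *: y);
  rewrite /D /= scalerA mulfV ?scale1r// oppr_eq0.
by exists l; rewrite /op_shift /D /= scaleNr addrC.
Qed.

(** A number above the spectral radius is not a spectral value, and a bounded inverse of [T - r] is
    a lower bound for it. *)
Lemma shift_bounded_below T r : bounded_op T -> spectral_radius T < r ->
  exists2 c, 0 < c & forall x, c * nrm x <= nrm (op_shift T r%:C x).
Proof.
move=> /nrm_bounded_op[M M0 TM] Tr.
(* [sup] bounds a set only if the set has an upper bound, so the spectrum is first confined to the
   disc of radius [M]. *)
have spec_le a : spectrum T a -> complex.Re `|a| <= M.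
  move=> sa; rewrite leNgt; apply/negP => Ma; apply: sa.
  have c0 : 0 < complex.Re `|a| - M by rewrite subr_gt0.
  have [V [VK KV VM]] :=
    bounded_below_inverse c0 (nrm_shift_ge a TM) (shift_surjective M0 TM Ma).
  exists V; split=> //; apply/nrm_bounded_op;
    exists (complex.Re `|a| - M)^-1 => //.
  by rewrite invr_ge0 ltW.
have : ~ spectrum T r%:C.
  move=> sr; suff : r <= spectral_radius T by rewrite leNgt Tr.
  apply: le_trans (_ : complex.Re `|r%:C| <= _).
    by rewrite normc_def/= expr0n/= addr0 sqrtr_sqr ler_norm.
  apply: sup_upper_bound; last by exists r%:C.
  split; first by exists (complex.Re `|r%:C|); exists r%:C.
  by exists M => _ [a sa <-]; exact: spec_le.
move=> /contrapT[V [/nrm_bounded_op[N N0 VN] VK _]].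
have N1 : 0 < N + 1 by rewrite ltr_wpDl.
exists (N + 1)^-1; first by rewrite invr_gt0.
move=> x; rewrite mulrC ler_pdivrMr// -{1}(VK x); apply: le_trans (VN _) _.
by rewrite mulrC ler_wpM2l ?nrm_ge0// lerDl.
Qed.

End bounded_below_operators.

(** * Restriction to an invariant subspace *)

Section invariant_subspace.
Context (R : realType) (H : hilbertType R) (T : {linear H -> H}).
Context (K : closedSubspace H) (TK : invariant_under T K).

Lemma restriction_linear : linear (restriction TK).
Proof. by move=> a x y; apply: val_inj; exact: (linearP T). Qed.

HB.instance Definition _ :=
  GRing.isLinear.Build _ _ _ _ (restriction TK) restriction_linear.

Hypothesis T_bounded : bounded_op T.

Let surj (b : R) := forall k : K, exists l : K,
  op_shift (restriction TK) b%:C l = k.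

(** [T - b] differs from [T - a] by multiplication by [a - b], which is a small perturbation when |a
    - b| is below the lower bound of [T - a]. *)
Let surj_near (a b c : R) : surj a ->
  (forall x, c * nrm x <= nrm (op_shift T a%:C x)) ->
  `|a - b| < c -> surj b.
Proof.
move=> sa ca ab k.
have [||l <-] := @surjective_perturbation _ K (op_shift (restriction TK) a%:C)
  ( *:%R (a - b)%:C) c `|a - b| (normr_ge0 _) ab _ _ sa k.
- by move=> x; exact: ca.
- by move=> x y; rewrite -scalerBr nrmZr.
by exists l; rewrite /op_shift rmorphB scalerBl addrA subrK.
Qed.

(* The set of [b >= r] for which [T - b] maps [K] onto [K] contains all large
   [b], and it is relatively open and closed in the ray because [T - b] is
   bounded below on the whole space. *)
Lemma restriction_shift_surjective (r : R) : spectral_radius T < r -> surj r.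
Proof.
move=> Tr; have /nrm_bounded_op[M M0 TM] := T_bounded.
pose E := [set b | r <= b /\ surj b].
have lbE : lbound E r by move=> b [].
have infE : has_inf E.
  split; last by exists r.
  (* Every number above [M] gives a surjective shift; the maximum also keeps it at least [r]. *)
  exists (Num.max r (M + 1)); split; first by rewrite le_max lexx.
  apply: (@shift_surjective _ _ _ _ M) => // [x|]; first exact: TM.
  rewrite normc_def/= expr0n/= addr0 sqrtr_sqr; apply: lt_le_trans (ler_norm _).
  by rewrite lt_max ltrDl ltr01 orbT.
have rm : r <= inf E by exact: lb_le_inf infE.1 lbE.
have [c c0 hc] := shift_bounded_below T_bounded (lt_le_trans Tr rm).
have c2 : 0 < c / 2 by rewrite divr_gt0.
have [b Eb bm] := inf_adherent c2 infE.
have mb : inf E <= b := ge_inf infE.2 Eb.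
(* Closedness: [b] is within [c / 2] of the infimum, so [T - b] is still bounded below by [c / 2],
   and surjectivity moves from [b] to [inf E]. *)
have surj_m : surj (inf E).
  apply: (@surj_near b _ (c / 2)) Eb.2 _ _;
    last by rewrite ger0_norm ?subr_ge0 ?ltrBlDl.
  move=> x; apply: (@le_trans _ _ (nrm (op_shift T (inf E)%:C x) - nrm ((b -
    inf E)%:C *: x))).
    rewrite lerBrDr; apply: le_trans (hc x).
    rewrite nrmZr ger0_norm ?subr_ge0// -mulrDl ler_wpM2r ?nrm_ge0//; lra.
  rewrite lerBlDr; apply: le_trans (nrmD _ _).
  by rewrite /op_shift rmorphB scalerBl addrA subrK.
(* Openness: a step of [c / 2] below the infimum, stopped at [r], stays in [E], so the infimum must
   be [r]. *)
have [b' Eb' b'm] : exists2 b', E b' & b' = Num.max r (inf E - c / 2).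
  eexists; last by [].
  split; first by rewrite le_max lexx.
  apply: (surj_near surj_m hc).
  have h : Num.max r (inf E - c / 2) <= inf E by rewrite ge_max rm; lra.
  rewrite ger0_norm ?subr_ge0//.
  have : inf E - c / 2 <= Num.max r (inf E - c / 2) by rewrite le_max lexx orbT.
  lra.
have := ge_inf infE.2 Eb'; rewrite b'm le_max => /orP[mr|]; last lra.
by have -> : r = inf E by apply/le_anti; rewrite rm mr.
Qed.

End invariant_subspace.

(** * Self-adjoint operators *)

Section hilbert_operators.
Context (R : realType).
Implicit Types H K : hilbertType R.

Lemma bounded_op_id H : bounded_op (idfun : {linear H -> H}).
Proof. by apply/nrm_bounded_op; exists 1 => // x; rewrite mul1r. Qed.

Lemma bounded_op_comp H1 H2 H3 (f : {linear H1 -> H2}) (g : {linear H2 -> H3}) :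
  bounded_op f -> bounded_op g -> bounded_op (g \o f).
Proof.
move=> /nrm_bounded_op[M M0 hf] /nrm_bounded_op[N N0 hg].
apply/nrm_bounded_op; exists (N * M); first exact: mulr_ge0.
by move=> x /=; apply: le_trans (hg _) _; rewrite -mulrA ler_wpM2l.
Qed.

(** Polarization: the norms of sums determine the real inner product, and with ['i] the complex
    one. *)
Lemma unitary_isometry H1 H2 (T : {linear H1 -> H2}) :
  (forall x, nrm (T x) = nrm x) -> (forall y, exists x, T x = y) -> unitary T.
Proof.
move=> Tnrm Tsurj; split; last first.
  by apply/seteqP; split=> // y _; have [x <-] := Tsurj y; exists x.
have Tr x y : rinner (T x) (T y) = rinner x y.
  have := nrmD_sq (T x) (T y); rewrite -(linearD T) !Tnrm nrmD_sq.
  lra.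
by move=> x y; apply: eq_inner_rinner; rewrite -?linearZ Tr.
Qed.

(** Symmetry extends by continuity in one argument at a time, so [close] is used twice. *)
Lemma selfadjoint_dense H (K : Type) (W : K -> H) (S : {linear H -> H}) :
  dense (range W) -> bounded_op S ->
  (forall k l, rinner (S (W k)) (W l) = rinner (W k) (S (W l))) ->
  selfadjoint S.
Proof.
move=> dW /nrm_bounded_op[M M0 SM] symW.
have rS x y : rinner (S x) y <= M * nrm x * nrm y.
  by apply: le_trans (rinner_le _ _) _; rewrite ler_wpM2r ?nrm_ge0.
have rS' x y : rinner x (S y) <= nrm x * (M * nrm y).
  by apply: le_trans (rinner_le _ _) _; rewrite ler_wpM2l ?nrm_ge0.
have close z : (forall k, rinner (S (W k)) z = rinner (W k) (S z)) ->
    forall x, rinner (S x) z = rinner x (S z).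
  move=> hz.
  have le x : rinner (S x) z <= rinner x (S z).
    rewrite -subr_le0; apply: (@dense_le0 _ _ _ x (2 * M * nrm z)) dW _.
    move=> _ [k _ <-].
    rewrite (_ : _ - _ = rinner (S (x - W k)) z + rinner (- (x - W k)) (S z)).
      apply: le_trans (lerD (rS _ _) (rS' _ _)) _.
      by rewrite nrmN le_eqVlt; apply/orP; left; apply/eqP; ring.
    rewrite (linearB S) rinnerNl !rinnerBl hz; ring.
  move=> x; apply/le_anti; rewrite le /=.
  by have := le (- x); rewrite (linearN S) !rinnerNl lerN2.
apply: is_adjoint_rinner => x y; apply: (close y) => k.
by rewrite rinnerC (rinnerC _ (S y)); apply/esym/close => l; exact: symW.
Qed.

Lemma opnorm_le H1 H2 (S : {linear H1 -> H2}) (M : R) : 0 <= M ->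
  (forall x, nrm (S x) <= M * nrm x) -> opnorm S <= M.
Proof.
move=> M0 SM; apply: sup_le_ub.
  by exists (complex.Re `|S 0|); exists 0 => //=; rewrite normr0.
move=> _ [x /= x1 <-]; apply: le_trans (SM x) _.
by rewrite ler_piMr// -le_nrm.
Qed.

Lemma nrm_le_opnorm H1 H2 (S : {linear H1 -> H2}) : bounded_op S ->
  0 <= opnorm S /\ forall x, nrm (S x) <= opnorm S * nrm x.
Proof.
move=> /nrm_bounded_op[M M0 SM].
have ub x : `|x| <= 1 -> nrm (S x) <= opnorm S.
  move=> x1; apply: sup_upper_bound; last by exists x.
  split; first by exists (nrm (S x)); exists x.
  exists M => _ [y /= y1 <-]; apply: le_trans (SM y) _.
  by rewrite ler_piMr// -le_nrm.
have S0 : 0 <= opnorm S.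
  by apply: le_trans (nrm_ge0 _) (ub 0 _); rewrite normr0.
split=> // x; have [x0|x0] := eqVneq (nrm x) 0.
  by rewrite (nrm0_eq0 x0) (linear0 S) !nrm0 mulr0.
have xgt0 : 0 < nrm x by rewrite lt_def nrm_ge0 x0.
have := ub ((nrm x)^-1%:C *: x).
rewrite (le_nrm _ 1) linearZ /= !nrmZr ger0_norm ?invr_ge0 ?nrm_ge0//.
by rewrite mulVf// lexx mulrC ler_pdivrMr//; apply.
Qed.

(* At a point where [nrm (S x)] is close to [opnorm S * nrm x], the vector
   [S (S x) - opnorm S ^ 2 x] is small. *)
Lemma opnorm_spectral H (K : Type) (W : K -> H) (S : {linear H -> H}) (c : R) :
  dense (range W) -> bounded_op S -> selfadjoint S -> 0 < opnorm S -> 0 < c ->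
  (forall k, c * nrm (W k) <= nrm (S (S (W k)) - (opnorm S ^+ 2)%:C *: W k)) ->
    False.
Proof.
move=> dW bS saS; have [_ Sle] := nrm_le_opnorm bS.
set s := opnorm S in Sle *; move=> s0 c0 hc.
(* For w in the range, expanding |S^2 w - s^2 w|^2 >= c^2 |w|^2 with |S^2 w| <= s |S w| and <S^2 w,
   w> = |S w|^2 gives |S w|^2 <= (s^2 - c^2 / s^2) |w|^2. *)
pose rho := Num.sqrt (s ^+ 2 - c ^+ 2 / s ^+ 2).
have s20 : 0 < s ^+ 2 by rewrite exprn_gt0.
have rho_lt : rho < s.
  rewrite -[X in _ < X](gtr0_norm s0) -sqrtr_sqr ltr_sqrt// gtrBl.
  by rewrite divr_gt0// exprn_gt0.
have SW k : nrm (S (W k)) <= rho * nrm (W k).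
  set w := W k.
  have h1 : (c * nrm w) ^+ 2 <= nrm (S (S w) - (s ^+ 2)%:C *: w) ^+ 2.
    by rewrite ler_pXn2r ?nnegrE ?mulr_ge0 ?nrm_ge0 ?(ltW c0)//; exact: hc.
  have h2 : nrm (S (S w)) ^+ 2 <= s ^+ 2 * nrm (S w) ^+ 2.
    by rewrite -exprMn ler_pXn2r ?nnegrE ?mulr_ge0 ?nrm_ge0 ?(ltW s0).
  have h3 : rinner (S (S w)) w = nrm (S w) ^+ 2.
    by rewrite -rinner_nrm /rinner saS.
  have h4 : nrm (S w) ^+ 2 <= (s ^+ 2 - c ^+ 2 / s ^+ 2) * nrm w ^+ 2.
    move: h1; rewrite nrmB_sq rinnerZr h3 nrmZr (gtr0_norm s20) !exprMn => h1.
    rewrite mulrBl lerBrDr -lerBrDl mulrAC ler_pdivrMr//.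
    lra.
  rewrite -(@ler_pXn2r _ 2) ?nnegrE ?mulr_ge0 ?nrm_ge0 ?sqrtr_ge0//.
  apply: le_trans h4 _; rewrite exprMn ler_wpM2r ?sqr_ge0//.
  (* For a negative radicand [Num.sqrt] returns [0], and the bound still holds. *)
  have [h|/ltW h] := leP 0 (s ^+ 2 - c ^+ 2 / s ^+ 2);
    first by rewrite sqr_sqrtr.
  by apply: le_trans h _; rewrite sqr_ge0.
have : s <= rho; last by rewrite leNgt rho_lt.
apply: opnorm_le; first exact: sqrtr_ge0.
move=> x; rewrite -subr_le0; apply: (@dense_le0 _ _ _ x (s + rho)) dW _.
move=> _ [k _ <-]; rewrite lerBlDr.
have h1 := Sle (x - W k); have h2 := SW k.
have h3 : nrm (S x) <= nrm (S (x - W k)) + nrm (S (W k)).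
  by rewrite (linearB S) -[X in X <= _]addr0 -{1}(subrK (S (W k)) (S x)) addr0
    nrmD.
have h4 : nrm (W k) <= nrm (x - W k) + nrm x.
  by rewrite nrmBC -{1}(subrK x (W k)) nrmD.
have rho0 : 0 <= rho by exact: sqrtr_ge0.
have := ler_wpM2l rho0 h4; lra.
Qed.

End hilbert_operators.

(** * The complex line as a Hilbert space *)

Section complex_line.
Context (R : realType).

(** A separate name for [R[i]], on which the Hilbert structure is built. *)
Definition complex_line : Type := R[i].

HB.instance Definition _ := NormedModule.copy complex_line R[i]^o.

Lemma Im_le_norm (a : R[i]) : `|complex.Im a|%:C <= `|a|.
Proof.
by rewrite normc_def lecR -sqrtr_sqr ler_wsqrtr// lerDr sqr_ge0.
Qed.

Lemma norm_le_ReIm (a : R[i]) : `|a| <= (`|complex.Re a| + `|complex.Im a|)%:C.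
Proof.
rewrite {1}[a]complexE; apply: le_trans (ler_normD _ _) _.
rewrite normrM !normc_def/= !expr0n/= !expr1n !addr0 add0r sqrtr1 !sqrtr_sqr.
by rewrite mul1r rmorphD.
Qed.

(** Real and imaginary parts are additive and 1-Lipschitz, so each sends a Cauchy filter to a
    convergent one in [R]. *)
Lemma complex_line_cauchy_cvg (F : set_system complex_line) :
  ProperFilter F -> cauchy F -> cvg F.
Proof.
move=> FF /cauchy_ballP Fc.
have coord (p : R[i] -> R) : (forall a b, p (a - b) = p a - p b) ->
    (forall a, `|p a|%:C <= `|a|) -> cvg (p @ F).
  move=> pB ple; apply: cauchy_cvg; apply/cauchy_ballP => e e0.
  have e0' : 0 < (e%:C : R[i]) by rewrite ltcR.
  have [[A B] /= [FA FB] AB] := Fc _ e0'.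
  exists (p @` A, p @` B) => /=; first split.
  - by apply: filterS FA => x Ax; exists x.
  - by apply: filterS FB => x Bx; exists x.
  - move=> [_ _] /= [[x Ax <-] [y By <-]].
    have := AB (x, y) (conj Ax By); rewrite -!ball_normE /ball_ /= -pB.
    by move=> xy; rewrite -ltcR; exact: le_lt_trans (ple _) xy.
have /cvg_ex[r Fr] := coord _ (fun a b => etrans (ReD a (- b)) (congr1 _ (ReN
  b))) (@normc_ge_Re R).
have ImB (a b : R[i]) : complex.Im (a - b) = complex.Im a - complex.Im b.
  by case: a; case: b.
have /cvg_ex[s Fs] := coord _ ImB Im_le_norm.
apply/cvg_ex; exists (r +i* s : R[i]); apply/cvgrPdist_lt => e e0.
have /complex_realP[t te] : e \is Num.real by rewrite gtr0_real.
rewrite te ltcR in e0 *.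
have t2 : 0 < t / 2 by rewrite divr_gt0.
move/cvgrPdist_lt : Fr => /(_ _ t2) Fr; move/cvgrPdist_lt : Fs => /(_ _ t2) Fs.
apply: filterS2 Fr Fs => z hr hs.
apply: le_lt_trans (norm_le_ReIm _) _; rewrite ltcR (splitr t) ltrD//.
  by case: z hr hs.
by case: z hr hs.
Qed.

HB.instance Definition _ := Uniform_isComplete.Build complex_line
  complex_line_cauchy_cvg.

Definition complex_line_inner (a b : complex_line) : R[i] :=
  (a : R[i]) * conjC (b : R[i]).

Let inner_bilinear : bilinear_for *%R (@conjC R[i] \; *%R) complex_line_inner.
Proof.
split=> [l a k k'|k a l l'] /=; rewrite /complex_line_inner.
  by rewrite mulrDl mulrA.
by rewrite rmorphD rmorphM mulrDr mulrCA.
Qed.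

HB.instance Definition _ :=
  bilinear_isBilinear.Build R[i] complex_line complex_line R[i] *%R (@conjC
    R[i] \; *%R)
    complex_line_inner inner_bilinear.

Let inner_herm k l :
  complex_line_inner k l = (-1) ^+ false * (complex_line_inner l k)^*%R.
Proof. by rewrite expr0 mul1r /complex_line_inner rmorphM /= conjCK mulrC. Qed.

HB.instance Definition _ :=
  isHermitianSesquilinear.Build R[i] complex_line false (@conjC R[i])
    complex_line_inner inner_herm.

Let inner_norm_sq k : complex_line_inner k k = `|k| ^+ 2.
Proof. by rewrite /complex_line_inner -normCK. Qed.

Let inner_gt0 k : k != 0 -> 0 < complex_line_inner k k.
Proof. by move=> k0; rewrite inner_norm_sq exprn_gt0// normr_gt0. Qed.

HB.instance Definition _ :=
  isDotProduct.Build R[i] complex_line complex_line_inner inner_gt0.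

HB.instance Definition _ :=
  CompleteNormedModule_isHilbert.Build R complex_line inner_norm_sq.

End complex_line.

(** * Reflection positivity *)

Section reflection_positive.
Context (R : realType) (H0 : hilbertType R) (K : closedSubspace H0) (P : H0 ->
  K).
Context (U J : {linear H0 -> H0}) (UK : invariant_under U K).
Hypothesis sys : reflection_system P U J.

Let J_le x : nrm (J x) = nrm x.
Proof.
have [_ _ [Jiso _] _ _] := sys.
have := Jiso x x; rewrite !inner_nrm => /complexI/eqP.
by rewrite eqrXn2 ?nrm_ge0// => /eqP.
Qed.

Let rinnerJ x y : rinner (J x) y = rinner x (J y).
Proof. by have [_ _ [Jiso _] JJ _] := sys;
  rewrite /rinner -Jiso [J (J x)]JJ. Qed.

(** <J U x, y> = <U x, J y> = <x, J U J J y> = <x, J U y> = <J x, U y>. *)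
Let rinnerJU x y : rinner (J (U x)) y = rinner (J x) (U y).
Proof.
have [_ _ _ JJ [UJ _]] := sys.
by rewrite rinnerJ {1}/rinner UJ /= [J (J y)]JJ -/(rinner _ _) -rinnerJ.
Qed.

Let inner_projection x (k : K) : inner (P x) k = inner x (val k).
Proof.
have [_ Porth _ _ _] := sys; apply/esym/subr0_eq.
by have := Porth x k; rewrite innerBl.
Qed.

(** [P x] is determined by its inner products with [K], which are linear in [x]. *)
Lemma projection_linear : linear P.
Proof.
move=> a x y; apply/subr0_eq/nrm0_eq0/eqP; rewrite -sqrf_eq0 -rinner_nrm.
set d := _ - _; rewrite {1}/d /rinner innerBl innerPl !inner_projection.
by rewrite innerPl subrr.
Qed.

Let PJ_linear : linear (compression P J).
Proof.
by move=> a k l; rewrite /compression -projection_linear -(linearP J).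
Qed.

Let rinner_PJ k l : rinner (compression P J k) l = rinner (J (val k)) (val l).
Proof. by rewrite /rinner inner_projection. Qed.

(** The identity W^* W = P J P in terms of inner products; it fixes the geometry of the range of
    [W]. *)
Lemma induced_rinner (HK : hilbertType R) (W : {linear K -> HK})
    (S : {linear HK -> HK}) k l :
  induced_system P J UK W S -> rinner (W k) (W l) = rinner (J (val k)) (val l).
Proof.
move=> [_ _ _ _ [_ [Wadj WW WP]]].
by rewrite rinnerC /rinner WW [Wadj (W k)]WP -/(rinner _ _) rinnerC rinner_PJ.
Qed.

Lemma factor_exists : exists (L : closedSubspace K) (W : {linear K -> L}),
  [/\ dense (range W),
      forall k l, rinner (W k) (W l) = rinner (J (val k)) (val l) &
      exists2 Wadj : L -> K, is_adjoint W Wadj & Wadj \o W =1 compression P J].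
Proof.
have [_ _ _ _ [_ PJ0]] := sys.
pose A : {linear K -> K} := HB.pack (compression P J)
  (GRing.isLinear.Build _ _ _ _ (compression P J) PJ_linear).
have A_sym x y : rinner (A x) y = rinner x (A y).
  by rewrite rinner_PJ rinnerJ [RHS]rinnerC rinner_PJ rinnerC.
have A_ge0 x : 0 <= rinner (A x) x.
  by have := PJ0 x; rewrite lecE => /andP[].
have A_le x : rinner (A x) x <= nrm x ^+ 2.
  by rewrite rinner_PJ; apply: le_trans (rinner_le _ _) _; rewrite J_le expr2.
(* The iteration gives a root of 1 - B; with B = 1 - A this is a root of [A]. *)
have [|x|x|Q [Q_sym QQ]] := @square_root_exists _ _ (idfun \- A).
- by move=> x y /=; rewrite rinnerBl rinnerBr A_sym.
- by rewrite /= rinnerBl rinner_nrm subr_ge0; exact: A_le.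
- by rewrite /= rinnerBl rinner_nrm gerBl; exact: A_ge0.
have QA x : Q (Q x) = A x by rewrite QQ /= opprB addrC subrK.
have [L [W [WQ dW]]] := closed_range_factor Q.
exists L, W; split=> // [k l|].
  by rewrite rinner_csub !WQ -Q_sym QA rinner_PJ.
(* The adjoint of [W] is [Q] restricted to [L]. *)
exists (fun y => Q (val y)); last by move=> k /=; rewrite WQ QA.
by apply: is_adjoint_rinner => x y; rewrite rinner_csub WQ Q_sym.
Qed.

(** * The operator [S] and its norm *)

Section induced_operator.
Context (HK : hilbertType R) (W : {linear K -> HK}).
Hypothesis W_dense : dense (range W).
Hypothesis W_form : forall k l, rinner (W k) (W l) = rinner (J (val k)) (val l).

Lemma factor_le k : nrm (W k) <= nrm k.
Proof.
rewrite -(@ler_pXn2r _ 2) ?nnegrE ?nrm_ge0// -rinner_nrm W_form.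
by apply: le_trans (rinner_le _ _) _; rewrite J_le expr2.
Qed.

Lemma factor_symmetric k l :
  rinner (W (restriction UK k)) (W l) = rinner (W k) (W (restriction UK l)).
Proof. by rewrite !W_form /= rinnerJU. Qed.

(** Symmetry for the form gives |W U k| <= M |W k|, so W k |-> W U k extends to a bounded
    operator. *)
Lemma induced_operator_exists : exists S : {linear HK -> HK},
  [/\ bounded_op S, selfadjoint S & S \o W =1 W \o restriction UK].
Proof.
have [/nrm_bounded_op[M M0 UM] _ _ _ _] := sys.
have [|S [SW SM]] := @dense_extension _ _ _ _ W (W \o restriction UK) M M0
  W_dense.
  exact: (@symmetrized_le _ _ _ W (restriction UK) M M0 factor_le
    (fun k => UM (val k)) factor_symmetric).
have Sb : bounded_op S by apply/nrm_bounded_op; exists M.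
exists S; split=> //; apply: (selfadjoint_dense W_dense Sb) => k l.
by rewrite ![S (W _)]SW /= factor_symmetric.
Qed.

Lemma induced_opnorm_le (S : {linear HK -> HK}) :
  bounded_op S -> selfadjoint S -> S \o W =1 W \o restriction UK ->
  opnorm S <= Num.sqrt (spectral_radius (U \o U)).
Proof.
move=> Sb Ssa SW; rewrite leNgt; apply/negP => lt.
set s := opnorm S in lt.
have s0 : 0 < s := le_lt_trans (sqrtr_ge0 _) lt.
have rs : spectral_radius (U \o U) < s ^+ 2.
  (* The sign is split because [Num.sqrt] of a negative number is [0]. *)
  have [r0|r0] := leP 0 (spectral_radius (U \o U)).
    by rewrite -(sqr_sqrtr r0) ltr_pXn2r ?nnegrE ?sqrtr_ge0// ltW.
  by apply: lt_trans r0 _; rewrite exprn_gt0.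
have UUb : bounded_op (U \o U) by have [Ub _ _ _ _] := sys;
  exact: bounded_op_comp.
have UUK : invariant_under (U \o U) K by move=> x xK; exact/UK/UK.
have [c c0 hc] := shift_bounded_below UUb rs.
pose D : {linear K -> K} := op_shift (restriction UUK) (s ^+ 2)%:C.
have Dc k : c * nrm k <= nrm (D k) by exact: hc.
have Dsurj k : exists l, D l = k by exact: (restriction_shift_surjective UUK
  UUb rs).
have [V [VK KV Vc]] := bounded_below_inverse c0 Dc Dsurj.
have UUE k : restriction UUK k = restriction UK (restriction UK k) by exact:
  val_inj.
have WD k : W (D k) = S (S (W k)) - (s ^+ 2)%:C *: W k.
  rewrite /D /= /op_shift (linearB W) linearZ /= UUE.
  by rewrite -[W (restriction UK _)]SW /= -[W (restriction UK _)]SW.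
have D_sym k l : rinner (W (D k)) (W l) = rinner (W k) (W (D l)).
  have SS x y : rinner (S x) y = rinner x (S y) by rewrite /rinner Ssa.
  by rewrite !WD rinnerBl rinnerBr rinnerZl rinnerZr !SS.
(* [V] inherits the symmetry of [D], so |W V k| <= c^-1 |W k|; with [D k] in place of [k] this
   bounds |W D k| below by c |W k|. *)
have V_le := @symmetrized_le _ _ _ W V c^-1 _ factor_le Vc.
apply: (opnorm_spectral W_dense Sb Ssa s0 c0) => k.
rewrite -WD -ler_pdivlMl// -{1}(VK k); apply: V_le;
  first by rewrite invr_ge0 ltW.
by move=> x y; rewrite -{1}(KV y) -{2}(KV x) D_sym.
Qed.

End induced_operator.

Lemma induced_system_exists :
  exists (HK : hilbertType R) (W : {linear K -> HK}) (S : {linear HK -> HK}),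
    induced_system P J UK W S /\
    opnorm S <= Num.sqrt (spectral_radius (U \o U)).
Proof.
have [L [W [dW Wform Wadj]]] := factor_exists.
have [S [Sb Ssa SW]] := induced_operator_exists dW Wform.
exists L, W, S; split; last exact: induced_opnorm_le Sb Ssa SW.
split=> // k; rewrite !nrmE lecR; exact: factor_le.
Qed.

Lemma induced_system_unique (H1 H2 : hilbertType R)
    (W1 : {linear K -> H1}) (S1 : {linear H1 -> H1})
    (W2 : {linear K -> H2}) (S2 : {linear H2 -> H2}) :
  induced_system P J UK W1 S1 -> induced_system P J UK W2 S2 ->
  exists T : {linear H1 -> H2},
    [/\ unitary T, T \o W1 =1 W2 & T \o S1 =1 S2 \o T].
Proof.
move=> I1 I2.
have W12 k : nrm (W1 k) = nrm (W2 k).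
  apply/eqP; rewrite -(@eqrXn2 _ 2) ?nrm_ge0// -!rinner_nrm.
  by rewrite (induced_rinner _ _ I1) (induced_rinner _ _ I2).
have [_ d1 bS1 _ [SW1 _]] := I1.
have [_ d2 bS2 _ [SW2 _]] := I2.
(* [T] and [T'] extend W1 k |-> W2 k and its inverse with constant 1. They are mutually inverse on
   dense ranges, hence everywhere, hence isometric. *)
have [|T [TW T1]] := @dense_extension _ _ _ _ W1 W2 1 ler01 d1.
  by move=> k; rewrite mul1r W12.
have [|T' [TW' T1']] := @dense_extension _ _ _ _ W2 W1 1 ler01 d2.
  by move=> k; rewrite mul1r W12.
have Tb : bounded_op T by apply/nrm_bounded_op; exists 1.
have T'b : bounded_op T' by apply/nrm_bounded_op; exists 1.
have T'T x : T' (T x) = x.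
  apply: (@eq_dense _ _ _ _ (T' \o T) idfun d1 (bounded_op_comp Tb T'b)
    (@bounded_op_id _ _)) => //.
  by move=> _ [k _ <-] /=; rewrite [T _]TW [T' _]TW'.
have TT' x : T (T' x) = x.
  apply: (@eq_dense _ _ _ _ (T \o T') idfun d2 (bounded_op_comp T'b Tb)
    (@bounded_op_id _ _)) => //.
  by move=> _ [k _ <-] /=; rewrite [T' _]TW' [T _]TW.
exists T; split=> //.
  apply: unitary_isometry => [x|y]; last by exists (T' y).
  apply/le_anti; have := T1 x; rewrite mul1r => -> /=.
  by have := T1' (T x); rewrite mul1r T'T.
apply: (@eq_dense _ _ _ _ (T \o S1) (S2 \o T) d1 (bounded_op_comp bS1 Tb)
  (bounded_op_comp Tb bS2)).
move=> _ [k _ <-] /=.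
by rewrite [S1 _]SW1 /= ![T (W1 _)]TW [RHS]SW2.
Qed.

End reflection_positive.

(** On the complex line, with [K] the whole space and U = J = 1, the form is the inner product, so
    every [W] is isometric. *)
Lemma injective_system_exists (R : realType) :
  exists (H0 : hilbertType R) (K : closedSubspace H0) (P : H0 -> K)
      (U J : {linear H0 -> H0}) (UK : invariant_under U K),
    [/\ reflection_system P U J,
        exists (HK : hilbertType R) (W : {linear K -> HK})
            (S : {linear HK -> HK}), induced_system P J UK W S &
        forall (HK : hilbertType R) (W : {linear K -> HK})
            (S : {linear HK -> HK}),
          induced_system P J UK W S -> forall k : K, W k = 0 -> k = 0].
Proof.
pose H0 : hilbertType R := complex_line R.
have KM : submod_closed (fun x : H0 => x \in [set: H0]).
  by split=> [|a x y _ _]; rewrite unfold_in; apply/mem_set.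
pose K := ClosedSubspace closedT KM.
have KT x : csub_pred K x by rewrite /csub_pred inE.
pose P x : K := CSub (KT x).
pose I : {linear H0 -> H0} := idfun.
have IK : invariant_under I K by [].
have sys : reflection_system P I I.
  split=> //.
  - exact: bounded_op_id.
  - by move=> x k; rewrite subrr linear0l.
  - by split=> //; apply/seteqP; split=> // y _; exists y.
  - by split=> // k; rewrite inner_norm exprn_ge0.
exists H0, K, P, I, I, IK; split=> //.
  by have [HK [W [S [WS _]]]] := induced_system_exists IK sys; exists HK, W, S.
move=> HK W S /(induced_rinner sys _ _) WS k Wk0.
have := WS k k; rewrite Wk0 /rinner linear0l -/(rinner _ _) rinner_nrm =>
  /esym/eqP.
by rewrite sqrf_eq0 => /eqP/nrm0_eq0 k0; exact: val_inj.
Qed.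

Theorem theorem3p1 (R : realType) :
  (forall (H0 : hilbertType R) (K : closedSubspace H0) (P : H0 -> K)
      (U J : {linear H0 -> H0}) (UK : invariant_under U K),
    reflection_system P U J ->
    (exists (HK : hilbertType R) (W : {linear K -> HK}) (S : {linear HK -> HK}),
       induced_system P J UK W S /\
       opnorm S <= Num.sqrt (spectral_radius (U \o U)))
    /\
    (forall (H1 H2 : hilbertType R)
        (W1 : {linear K -> H1}) (S1 : {linear H1 -> H1})
        (W2 : {linear K -> H2}) (S2 : {linear H2 -> H2}),
       induced_system P J UK W1 S1 -> induced_system P J UK W2 S2 ->
       exists T : {linear H1 -> H2},
         [/\ unitary T, T \o W1 =1 W2 & T \o S1 =1 S2 \o T]))
  /\
  (exists (H0 : hilbertType R) (K : closedSubspace H0) (P : H0 -> K)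
      (U J : {linear H0 -> H0}) (UK : invariant_under U K),
    [/\ reflection_system P U J,
        exists (HK : hilbertType R) (W : {linear K -> HK})
            (S : {linear HK -> HK}), induced_system P J UK W S &
        forall (HK : hilbertType R) (W : {linear K -> HK})
            (S : {linear HK -> HK}),
          induced_system P J UK W S -> forall k : K, W k = 0 -> k = 0]).
Proof.
split; last exact: injective_system_exists.
move=> H0 K P U J UK sys; split; first exact: induced_system_exists.
exact: induced_system_unique.
Qed.
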